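(* Let $G$ be a finite abelian group with the UPT property. Suppose $m$ is a square-free positive integer such that $\gcd(|G|,m)=1$. Then the direct product group $G\times\mathbb{Z}_m$ has the UPT property, and hence the PT property.
   Context: $\mathbb{Z}_m$ denotes the cyclic group of order $m$. For a finite abelian group $G$ (written additively), a pair $(\Omega,T)$ of subsets of $G$ is a tiling pair if every $g\in G$ can be written uniquely as $g=\omega+t$ with $\omega\in\Omega$, $t\in T$; then $\Omega$ is called a tile and $T$ a tiling complement of $\Omega$. $\mathcal{T}_\Omega$ denotes the set of all tiling complements of a tile $\Omega$. A nonempty subset $A\subset G$ is periodic if there is a nonzero $g\in G$ (a period of $A$) with $A+g=A$. $G$ has the PT property if for every tiling pair $(\Omega,T)$ of $G$, either $\Omega$ is periodic, or there is a periodic set $T'\subset G$ such that $(\Omega,T')$ is also a tiling pair. A tile $\Omega$ is uniformly periodic if there is $g\in G\setminus\{0\}$ with $T+g=T$ for every $T\in\mathcal{T}_\Omega$. A tile $\Omega$ is dual uniformly periodic if there is a periodic tile $\Omega'$ such that $(\Omega',T)$ is a tiling pair for each $T\in\mathcal{T}_\Omega$. $G$ has the uniformly periodic tiling property (UPT property) if every tile in $G$ is either uniformly periodic or dual uniformly periodic. Convention: the trivial group is regarded as having the PT and UPT properties. *)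

(* Defs.v *)
From HB Require Import structures.
From mathcomp Require Import all_boot all_order all_algebra.

Set Implicit Arguments.
Unset Strict Implicit.
Unset Printing Implicit Defensive.

Import GRing.Theory.
Local Open Scope ring_scope.

Definition squarefree (m : nat) : Prop :=
  forall d : nat, (d ^ 2 %| m)%N -> d = 1%N.

(* ['I_n.+1] carries addition modulo [n.+1].  For [0 < m] this is the cyclic
   group of order [m], including [m = 1], where ['Z_m] would have order 2. *)
Notation cyclic_group m := ('I_m.-1.+1) (only parsing).

(* The library has finite and additive structures on products, but not their
   join [finZmodType]. *)
HB.instance Definition _ (G H : finZmodType) := Finite.on (G * H)%type.

Section Tilings.
Variable G : finZmodType.
Implicit Types (A Omega T : {set G}) (g : G).

Definition translate A g : {set G} := [set a + g | a in A].

Definition tiling_pair Omega T : Prop :=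
  forall g, exists! p : G * G,
    [/\ p.1 \in Omega, p.2 \in T & g = p.1 + p.2].

Definition tile Omega : Prop := exists T, tiling_pair Omega T.

Definition is_period A g : Prop := g <> 0 /\ translate A g = A.

Definition periodic A : Prop := A <> set0 /\ exists g, is_period A g.

Definition uniformly_periodic Omega : Prop :=
  tile Omega /\
  exists g, g <> 0 /\ forall T, tiling_pair Omega T -> translate T g = T.

Definition dual_uniformly_periodic Omega : Prop :=
  tile Omega /\
  exists Omega', [/\ tile Omega', periodic Omega' &
    forall T, tiling_pair Omega T -> tiling_pair Omega' T].

(* No subset of the trivial group is periodic, so the trivial group has to be
   admitted separately in the two properties below. *)
Definition PT_property : Prop :=
  #|G| = 1%N \/
  forall Omega T, tiling_pair Omega T ->
    periodic Omega \/ exists T', periodic T' /\ tiling_pair Omega T'.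

Definition UPT_property : Prop :=
  #|G| = 1%N \/
  forall Omega, tile Omega ->
    uniformly_periodic Omega \/ dual_uniformly_periodic Omega.

End Tilings.

Arguments PT_property G : clear implicits.
Arguments UPT_property G : clear implicits.

(* Main.v *)
(* If (A, B) tiles a finite abelian group and n is prime to #|A|, then (nA, B)
   tiles too: for n prime this is Frobenius in the group ring modulo n.
   Let A be a tile of H = G x Z_m.
   If a prime p divides both m and #|A|, then p divides no #|T| with T a
   complement of A, and the set of h with p h in A is a complement of all these
   T; it is invariant under the elements of order p.
   Otherwise #|A| is prime to m and all complements T of A are complements of
   m A, which has the form A1 x 0: the slices of T are complements of A1 in G,
   and the UPT property of G for A1 lifts to A.
   The PT property for (A, B) is the UPT property of the tile B, of which A is
   a complement. *)
Require Import Defs.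
From mathcomp Require Import all_boot all_order all_algebra.

Set Implicit Arguments.
Unset Strict Implicit.
Unset Printing Implicit Defensive.

Import GRing.Theory.
Local Open Scope ring_scope.

(** * Tiling pairs: symmetry and counting *)

Section TilingFacts.
Variable H : finZmodType.
Implicit Types A B : {set H}.

Lemma tiling_pair_swap A B : tiling_pair A B -> tiling_pair B A.
Proof.
move=> tAB g; have [[a b] [/= [aA bB ->] uniq_ab]] := tAB g.
exists (b, a); split=> [|[b' a'] [/= b'B a'A ba]]; first by rewrite addrC.
by have [<- <-] := uniq_ab (a', b') (And3 a'A b'B (etrans ba (addrC _ _))).
Qed.

Lemma tiling_pair_cover A B h :
  tiling_pair A B -> exists a b, [/\ a \in A, b \in B & h = a + b].
Proof. by move=> /(_ h) [[a b] [? _]]; exists a, b. Qed.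

Lemma tiling_pair_inj A B : tiling_pair A B ->
  {in setX A B &, injective (fun x => x.1 + x.2)}.
Proof.
move=> tAB x y; rewrite !inE => /andP[xA xB] /andP[yA yB] exy.
have [z [_ uniq_z]] := tAB (x.1 + x.2).
by rewrite -(uniq_z x) // -(uniq_z y).
Qed.

Lemma tiling_pair_imset A B : tiling_pair A B ->
  [set x.1 + x.2 | x in setX A B] = setT.
Proof.
move=> tAB; apply/setP=> h; rewrite inE; apply/imsetP.
have [a [b [aA bB ->]]] := tiling_pair_cover h tAB.
by exists (a, b); rewrite ?inE ?aA.
Qed.

Lemma tiling_pair_card A B : tiling_pair A B -> (#|A| * #|B|)%N = #|H|.
Proof.
move=> tAB; rewrite -cardsX -(card_in_imset (tiling_pair_inj tAB)).
by rewrite tiling_pair_imset // cardsT.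
Qed.

Lemma tiling_pair_card_gt0 A B :
  tiling_pair A B -> (0 < #|A|)%N && (0 < #|B|)%N.
Proof.
by move=> /tiling_pair_card eqH; rewrite -muln_gt0 eqH; apply/card_gt0P; exists 0.
Qed.

(** Pigeonhole: a surjection onto [H] from at most [#|H|] pairs is injective, so uniqueness comes
    for free. *)
Lemma tiling_pair_of_cover A B :
  (#|A| * #|B| <= #|H|)%N ->
  (forall h, exists a b, [/\ a \in A, b \in B & h = a + b]) ->
  tiling_pair A B.
Proof.
move=> leAB cov.
have inj : {in setX A B &, injective (fun x => x.1 + x.2)}.
  apply/imset_injP; rewrite eqn_leq leq_imset_card cardsX (leq_trans leAB) //.
  rewrite -cardsT; apply/subset_leq_card/subsetP=> h _.
  have [a [b [aA bB ->]]] := cov h.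
  by apply/imsetP; exists (a, b); rewrite ?inE ?aA.
move=> h; have [a [b [aA bB ->]]] := cov h.
exists (a, b); split=> // -[a' b'] [/= a'A b'B e].
by apply: inj; rewrite ?inE /= ?aA ?a'A.
Qed.

End TilingFacts.

(** Stated for commuting terms because it is applied in a matrix ring. *)
Lemma Frobenius_sum_comm (R : nzRingType) (p : nat) (I : Type) (s : seq I)
    (P : pred I) (F : I -> R) :
  p \in [pchar R] -> (forall i j, GRing.comm (F i) (F j)) ->
  (\sum_(i <- s | P i) F i) ^+ p = \sum_(i <- s | P i) F i ^+ p.
Proof.
move=> pR cF; elim: s => [|i s IHs].
  by rewrite !big_nil -(pFrobenius_autE pR) pFrobenius_aut0.
rewrite !big_cons; case: (P i) => //; rewrite -IHs -!(pFrobenius_autE pR).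
by apply: pFrobenius_autD_comm; apply: commr_sum => j _; apply: cF.
Qed.

(** * The group ring modulo a prime *)

Section GroupRing.
Variables (p : nat) (H : finZmodType).
Hypothesis p_pr : prime p.
Implicit Types A B : {set H}.

(** The matrix size is a syntactic successor so that the square matrices form a nonzero ring. *)
Let cardH : #|H|.-1.+1 = #|H|.
Proof. by apply/prednK/card_gt0P; exists 0. Qed.

Let elt (i : 'I_(#|H|.-1.+1)) : H := enum_val (cast_ord cardH i).
Let idx (h : H) : 'I_(#|H|.-1.+1) := cast_ord (esym cardH) (enum_rank h).

Let idxK : cancel idx elt.
Proof. by move=> h; rewrite /elt /idx cast_ordKV enum_rankK. Qed.

Let eltK : cancel elt idx.
Proof. by move=> i; rewrite /elt /idx enum_valK cast_ordK. Qed.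

(* The regular representation of [H] over [F_p]; its linear span is a copy of
   the group ring [F_p[H]]. *)
Definition shift_mx (h : H) : 'M['F_p]_(#|H|.-1.+1) :=
  \matrix_(i, j) (elt j == elt i + h)%:R.

Lemma shift_mxD h k : shift_mx (h + k) = shift_mx h * shift_mx k.
Proof.
apply/matrixP=> i j; rewrite -mulmxE !mxE (bigD1 (idx (elt i + h))) //= !mxE idxK.
rewrite eqxx mul1r addrA big1 ?addr0 // => l neq; rewrite !mxE.
by case: (elt l =P _) neq => [<-|]; rewrite ?eltK ?eqxx ?mul0r.
Qed.

Lemma shift_mxMn h n : (0 < n)%N -> shift_mx (h *+ n) = shift_mx h ^+ n.
Proof.
case: n => // n _; elim: n => [|n IHn] //.
by rewrite mulrS shift_mxD IHn -exprS.
Qed.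

Lemma shift_mx_comm h k : GRing.comm (shift_mx h) (shift_mx k).
Proof. by rewrite /GRing.comm -!shift_mxD addrC. Qed.

Lemma sum_shift_mx : \sum_h shift_mx h = const_mx 1.
Proof.
apply/matrixP=> i j; rewrite summxE mxE (bigD1 (elt j - elt i)) //= mxE.
rewrite [elt i + _]addrC subrK eqxx big1 ?addr0 // => h neq; rewrite mxE.
by case: (elt j =P _) neq => // ->; rewrite [elt i + _]addrC addrK eqxx.
Qed.

Lemma shift_mx_sum_all k :
  shift_mx k * (\sum_h shift_mx h) = \sum_h shift_mx h.
Proof.
rewrite mulr_sumr [RHS](reindex (+%R k)) /=.
  by apply: eq_bigr => h _; rewrite shift_mxD.
by exists (+%R (- k)) => h _; rewrite ?addKr ?addNKr.
Qed.

(** Expanding the product gives one term per pair, and the sums of the pairs run through [H] exactly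
    once. *)
Lemma shift_mx_tiling A B : tiling_pair A B ->
  (\sum_(a in A) shift_mx a) * (\sum_(b in B) shift_mx b)
    = \sum_h shift_mx h.
Proof.
move=> tAB; transitivity (\sum_(h in [set: H]) shift_mx h); last first.
  by apply: eq_bigl => h; rewrite inE.
rewrite -(tiling_pair_imset tAB) big_imset /=; last exact: tiling_pair_inj.
rewrite big_distrlr /= pair_big /=; apply: eq_big => [x|x _].
  by rewrite inE.
by rewrite shift_mxD.
Qed.

(* Modulo [p], the indicator of [A] to the power [p] is the sum of the
   [p *: a], so multiplying it by the indicator of [B] yields the constant
   [#|A| ^ p.-1], which is nonzero: every element is covered. *)
Lemma tiling_pair_dilate_cover A B h :
  ~~ (p %| #|A|)%N -> tiling_pair A B ->
  exists a b, [/\ a \in A, b \in B & h = a *+ p + b].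
Proof.
move=> pA tAB; pose S (C : {set H}) := \sum_(c in C) shift_mx c.
have pF := pchar_Fp p_pr.
have pM : p \in [pchar 'M['F_p]_(#|H|.-1.+1)] by rewrite pchar_lalg.
have eqSp : S A ^+ p = \sum_(a in A) shift_mx (a *+ p).
  rewrite /S Frobenius_sum_comm //; last exact: shift_mx_comm.
  by apply: eq_bigr => a _; rewrite shift_mxMn ?prime_gt0.
(* Translations fix the sum over [H], so each factor [S A] multiplies it by [#|A|]. *)
have absorb n : S A ^+ n * (\sum_h shift_mx h)
    = (\sum_h shift_mx h) *+ (#|A| ^ n).
  elim: n => [|n IHn]; first by rewrite mul1r.
  rewrite exprS -mulrA IHn mulrnAr mulr_suml.
  under eq_bigr do rewrite shift_mx_sum_all.
  by rewrite sumr_const -mulrnA -expnS.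
have: S A ^+ p * S B = const_mx 1 *+ (#|A| ^ p.-1).
  have ->: S A ^+ p = S A ^+ p.-1 * S A.
    by rewrite -exprSr; congr (S A ^+ _); rewrite prednK ?prime_gt0.
  by rewrite -mulrA shift_mx_tiling // absorb sum_shift_mx.
(* This entry is the coefficient of [h] in the group ring. *)
move/matrixP/(_ (idx 0) (idx h)); rewrite mulmxnE [in RHS]mxE => eqh.
suff /existsP[a /existsP[b /and3P[aA bB /eqP eh]]] :
    [exists a, exists b, [&& a \in A, b \in B & h == a *+ p + b]].
  by exists a, b.
apply: contraT => nex.
have: (#|A| ^ p.-1)%:R != 0 :> 'F_p.
  by rewrite -(dvdn_pcharf pF) Euclid_dvdX // (negPf pA).
rewrite -eqh eqSp mulr_suml summxE big1 ?eqxx // => a aA.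
rewrite mulr_sumr summxE big1 // => b bB.
rewrite -shift_mxD mxE !idxK add0r; case: eqP => // eh.
by case/existsP: nex; exists a; apply/existsP; exists b; rewrite aA bB eh eqxx.
Qed.

End GroupRing.

(** * Dilates and preimages under multiplication by an integer *)

Section Dilation.
Variable H : finZmodType.
Implicit Types A B : {set H}.

Definition dilate A n : {set H} := [set a *+ n | a in A].

Lemma mem_dilate A n a : a \in A -> a *+ n \in dilate A n.
Proof. by move=> aA; apply/imsetP; exists a. Qed.

Lemma dilateM A n k : dilate A (n * k) = dilate (dilate A n) k.
Proof.
by rewrite /dilate -imset_comp; apply: eq_imset => a /=; rewrite mulrnA.
Qed.

Lemma tiling_pair_dilate_prime p A B :
  prime p -> ~~ (p %| #|A|)%N -> tiling_pair A B -> tiling_pair (dilate A p) B.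
Proof.
move=> p_pr pA tAB; apply: tiling_pair_of_cover => [|h].
  by rewrite -(tiling_pair_card tAB) leq_mul2r leq_imset_card orbT.
have [a [b [aA bB ->]]] := tiling_pair_dilate_cover p_pr h pA tAB.
by exists (a *+ p), b; rewrite mem_dilate.
Qed.

Lemma tiling_pair_card_eq A A' B :
  tiling_pair A B -> tiling_pair A' B -> #|A| = #|A'|.
Proof.
move=> tAB tA'B; have /andP[_ B_gt0] := tiling_pair_card_gt0 tAB.
apply/eqP; rewrite -(eqn_pmul2r B_gt0).
by rewrite (tiling_pair_card tAB) (tiling_pair_card tA'B).
Qed.

(** Prime factors of [n] are peeled off one at a time. Each dilate shares the complement [B], hence
    keeps the cardinality of [A], so coprimality persists. *)
Lemma tiling_pair_dilate n A B :
  (0 < n)%N -> coprime #|A| n -> tiling_pair A B -> tiling_pair (dilate A n) B.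
Proof.
have [k] := ubnP n; elim: k n A => // k IHk n A lenk n_gt0 coAn tAB.
have [n1|n_gt1] := leqP n 1.
  have -> : n = 1%N by apply/eqP; rewrite eqn_leq n1.
  by rewrite /dilate (eq_imset (g := id)) ?imset_id.
have p_pr := pdiv_prime n_gt1; have dvp := pdiv_dvd n.
have tApB : tiling_pair (dilate A (pdiv n)) B.
  apply: tiling_pair_dilate_prime => //.
  by rewrite -prime_coprime // coprime_sym (coprime_dvdr dvp).
rewrite -(divnK dvp) mulnC dilateM; apply: IHk => //.
- exact: leq_trans (ltn_Pdiv (prime_gt1 p_pr) n_gt0) lenk.
- by rewrite divn_gt0 ?prime_gt0 // dvdn_leq.
- rewrite -(tiling_pair_card_eq tAB tApB).
  by apply: coprime_dvdr coAn; apply: dvdn_div.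
Qed.

(** The dilate of [B] also complements [A], and multiplication by [n] is injective on [B].
    Decomposing [h *+ n] thus singles out one [b], and [h - b] lies in the preimage. *)
Lemma tiling_pair_preim n A B :
  (0 < n)%N -> coprime #|B| n -> tiling_pair A B ->
  tiling_pair [set h | h *+ n \in A] B.
Proof.
move=> n_gt0 coBn tAB.
have tBA := tiling_pair_dilate n_gt0 coBn (tiling_pair_swap tAB).
have inj_n : {in B &, injective (fun b => b *+ n)}.
  by apply/imset_injP; rewrite (tiling_pair_card_eq tBA (tiling_pair_swap tAB)).
move=> h; have [b [a []]] := tiling_pair_cover (h *+ n) tBA.
move=> /imsetP[{}b bB ->] aA eh.
exists (h - b, b); split=> [|[a' b'] [/=]].
  by rewrite /= inE mulrnBl eh addrC addKr subrK.
rewrite inE => a'A b'B eh'.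
have : (b' *+ n, a' *+ n) = (b *+ n, a).
  apply: (tiling_pair_inj tBA); rewrite ?inE /= ?mem_dilate ?aA ?a'A //.
  by rewrite -eh eh' mulrnDl addrC.
by case=> /inj_n<- // _; rewrite eh' addrK.
Qed.

End Dilation.

(** * Translates and slices in a product group *)

Lemma mem_translate (G : finZmodType) (A : {set G}) g x :
  (x \in translate A g) = (x - g \in A).
Proof.
apply/imsetP/idP=> [[a aA ->]|xgA]; first by rewrite addrK.
by exists (x - g); rewrite ?subrK.
Qed.

Section Product.
Variables G K : finZmodType.
Implicit Types (A : {set G}) (T : {set (G * K)%type}).

Definition slice T j : {set G} := [set g | (g, j) \in T].

(** Adding an element of [setX A [set 0]] keeps the second coordinate, so the tiling condition
    splits into one condition per [j]. *)
Lemma tiling_pair_slice A T :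
  tiling_pair (setX A [set 0]) T <-> forall j, tiling_pair A (slice T j).
Proof.
split=> [tAT j g | tAT [g j]].
  have [[[a i] [b l]] [/= [aA bT eg] uniq]] := tAT (g, j).
  move: aA eg; rewrite !inE => /andP[/= aA /eqP i0].
  rewrite i0 => -[eg ej]; rewrite add0r in ej; subst l.
  exists (a, b); split=> [|[a' b'] [/= a'A b'T eg']]; first by rewrite inE.
  rewrite inE in b'T.
  have [] : ((a, i), (b, j)) = ((a', 0), (b', j)) :> (G * K) * (G * K).
    apply: uniq; rewrite !inE /= a'A b'T eqxx eg'; split=> //.
    by congr (_, _); rewrite add0r.
  by move=> -> _ ->.
have [[a b] [/= [aA bT ->] uniq]] := tAT j g; rewrite inE in bT.
exists ((a, 0), (b, j)); split=> [|[[a' i'] [b' j']]] /=.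
  by rewrite !inE aA eqxx /=; split=> //; congr (_, _); rewrite add0r.
rewrite !inE => -[/andP[/= a'A /eqP->] b'T [eg]]; rewrite add0r => ej.
subst j'; have [-> ->] : (a, b) = (a', b') by apply: uniq; rewrite inE.
by [].
Qed.

Lemma translate_slice T g :
  (forall j, translate (slice T j) g = slice T j) -> translate T (g, 0) = T.
Proof.
move=> perT; apply/setP=> -[x j]; rewrite mem_translate.
have /setP/(_ x) := perT j; rewrite mem_translate !inE => <-.
by congr (_ \in T); congr (_, _); rewrite subr0.
Qed.

Lemma translate_setX0 A g :
  translate (setX A [set 0 : K]) (g, 0) = setX (translate A g) [set 0].
Proof.
by apply/setP=> -[x j]; rewrite mem_translate !inE /= mem_translate subr0.
Qed.

End Product.

(** * The UPT and PT properties *)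

Lemma tiling_pair_neq0 (G : finZmodType) (A B : {set G}) :
  tiling_pair A B -> A <> set0.
Proof.
by move=> /tiling_pair_card_gt0/andP[A_gt0 _] A0; rewrite A0 cards0 in A_gt0.
Qed.

Lemma UPT_PT (G : finZmodType) : UPT_property G -> PT_property G.
Proof.
case=> [G1|upt]; [by left | right=> A B tAB].
have tBA := tiling_pair_swap tAB.
case: (upt B); first by exists A.
  move=> [_ [g [g0 perg]]]; left; split; first exact: tiling_pair_neq0 tAB.
  by exists g; split=> //; apply: perg.
move=> [_ [B' [_ perB' tB']]]; right; exists B'; split=> //.
exact/tiling_pair_swap/tB'.
Qed.

Lemma UPT_prod_cyclic (G : finZmodType) (n : nat) :
  UPT_property G -> squarefree n.+1 -> coprime #|G| n.+1 ->
  UPT_property (G * 'I_n.+1)%type.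
Proof.
move=> uptG sqf coGm; set m := n.+1 in sqf coGm *.
have cardH : #|{: (G * 'I_m)%type}| = (#|G| * m)%N by rewrite card_prod card_ord.
have [H1|H_neq1] := eqVneq #|{: (G * 'I_m)%type}| 1%N; first by left.
right=> A tileA; have [T0 tAT0] := tileA.
have [coAm|ncoAm] := boolP (coprime #|A| m); last first.
  right; split=> //; set p := pdiv (gcdn #|A| m).
  have p_pr : prime p.
    apply: pdiv_prime; rewrite ltn_neqAle eq_sym gcdn_gt0 orbT andbT.
    exact: ncoAm.
  have pA : (p %| #|A|)%N := dvdn_trans (pdiv_dvd _) (dvdn_gcdl _ _).
  have pm : (p %| m)%N := dvdn_trans (pdiv_dvd _) (dvdn_gcdr _ _).
  (* Otherwise [p ^ 2] divides [#|G| * m], hence [m], as [p] is prime to [#|G|]; this contradicts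
     square-freeness. *)
  have coT T : tiling_pair A T -> coprime #|T| p.
    move=> /tiling_pair_card; rewrite cardH coprime_sym prime_coprime // => eAT.
    apply/negP=> pT; have : (p ^ 2 %| #|G| * m)%N by rewrite -eAT expnS dvdn_mul.
    rewrite Gauss_dvdr => [/sqf p1|]; first by rewrite p1 in p_pr.
    by rewrite coprimeXl // coprime_sym (coprime_dvdr pm).
  have tA'T T : tiling_pair A T -> tiling_pair [set h | h *+ p \in A] T.
    by move=> tAT; apply: tiling_pair_preim (coT _ tAT) tAT; apply: prime_gt0.
  exists [set h | h *+ p \in A]; split=> //; first by exists T0; apply: tA'T.
  split; first exact: tiling_pair_neq0 (tA'T _ tAT0).
  (* An element of order [p]: [h] and [h - c] have the same multiple by [p], so [c] is a period of
     the preimage. *)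
  pose c : G * 'I_m := (0, inZp (m %/ p)).
  have cp0 : c *+ p = 0.
    rewrite pairMnE mul0rn Zp_mulrn; congr (_, _); apply: val_inj => /=.
    by rewrite modnMml divnK // modnn.
  have q_gt0 : (0 < m %/ p)%N by rewrite divn_gt0 ?prime_gt0 // dvdn_leq.
  exists c; split.
    by move=> [/eqP]; rewrite modn_small ?ltn_Pdiv ?prime_gt1 // eqn0Ngt q_gt0.
  by apply/setP=> h; rewrite mem_translate !inE mulrnBl cp0 subr0.
(* Multiplication by [m] kills the cyclic factor, so projecting to [G] loses nothing. *)
pose A1 : {set G} := [set x.1 | x in dilate A m].
have eqA1 : dilate A m = setX A1 [set 0].
  have snd0 (x : G * 'I_m) : (x *+ m).2 = 0.
    by rewrite pairMnE Zp_mulrn /=; apply: val_inj; rewrite /= modnMl.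
  apply/setP=> -[g j]; rewrite !inE /=; apply/idP/andP=> [gj|[/imsetP[x]]].
    split; first by apply/imsetP; exists (g, j).
    by case/imsetP: gj => a _ /(congr1 snd) /= ->; rewrite snd0.
  case/imsetP=> a aA -> -> /eqP->.
  by rewrite -(snd0 a) -surjective_pairing mem_dilate.
have tA1 T : tiling_pair A T -> forall j, tiling_pair A1 (slice T j).
  by move=> tAT; apply/tiling_pair_slice; rewrite -eqA1; apply: tiling_pair_dilate.
case: uptG => [G1|uptG].
  (* For trivial [G], [#|A|] divides [m] and is prime to it, so [A] is a singleton. Its only
     complement is the whole group, and any nonzero [g] is a period. *)
  left; split=> //.
  have [g g0] : exists g : G * 'I_m, g != 0.
    have : (1 < #|{: (G * 'I_m)%type}|)%N.
      by rewrite ltn_neqAle eq_sym H_neq1; apply/card_gt0P; exists 0.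
    by case/card_gt1P=> x [y [_ _]]; exists (x - y); rewrite subr_eq0.
  exists g; split; first exact/eqP.
  move=> T tAT; suff -> : T = setT.
    by apply/setP=> x; rewrite mem_translate !inE.
  apply/eqP; rewrite eqEcard subsetT cardsT -(tiling_pair_card tAT).
  suff -> : #|A| = 1%N by rewrite mul1n leqnn.
  apply/eqP; rewrite -dvdn1 -(eqP coAm) dvdn_gcd dvdnn -[X in (_ %| X)%N]mul1n.
  by rewrite -G1 -cardH -(tiling_pair_card tAT) dvdn_mulr.
case: (uptG A1) => [|[_ [g [g0 perg]]]|[_ [A2 [_ [_ [g [g0 perg]]] tA2T]]]].
- by exists (slice T0 0); apply: tA1.
(* All slices of all complements share the period [g]. *)
- left; split=> //; exists (g, 0); split=> [[]//|T tAT].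
  by apply: translate_slice => j; apply/perg/tA1.
(* The periodic [A2] complements every slice, so the slices reassemble into a tiling by [T]. *)
have tA2' T : tiling_pair A T -> tiling_pair (setX A2 [set 0]) T.
  by move=> tAT; apply/tiling_pair_slice => j; apply/tA2T/tA1.
right; split=> //; exists (setX A2 [set 0]); split; first 2 last.
- exact: tA2'.
- by exists T0; apply: tA2'.
split; first exact: tiling_pair_neq0 (tA2' _ tAT0).
by exists (g, 0); split=> [[]//|]; rewrite translate_setX0 perg.
Qed.

Theorem theorem1p2 (G : finZmodType) (m : nat) :
  UPT_property G ->
  (0 < m)%N ->
  squarefree m ->
  gcdn #|G| m = 1%N ->
  UPT_property (G * cyclic_group m)%type /\
  PT_property (G * cyclic_group m)%type.
Proof.
case: m => // n uptG _ sqf /eqP coGm.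
have uptH := UPT_prod_cyclic uptG sqf coGm.
by split; last exact: UPT_PT.
Qed.
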